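(* Let $p$ be a positive integer and let $L\in\mathbb{R}^{3\times 3}$. Define $F:\mathbb{R}^{p\times p}\to\mathbb{R}^{p\times p}$ by $F(U)=L*U$. Then there exist parameters $$\mathcal{K}\in\mathbb{R}^{2\times 1\times 3\times 3},\quad \mathcal{H}\in\mathbb{R}^{1\times 2\times 1\times 1},\quad b_1\in\mathbb{R}^{2},\quad b_2\in\mathbb{R},$$ such that the map $$F_\theta(U)=\mathcal{H}*\sigma_1\left(\mathcal{K}*U+b_1\right)+b_2,\qquad \theta=(\mathcal{K},\mathcal{H},b_1,b_2),$$ where $\sigma_1(x)=\mathrm{ReLU}(x)=\max\{0,x\}$ is applied entry-wise, satisfies $F_\theta(U)=F(U)$ for every $U\in\mathbb{R}^{p\times p}$.
   Context: Convolution with a single filter (''same'' convolution with periodic padding): for $K\in\mathbb{R}^{3\times 3}$ and $U\in\mathbb{R}^{p\times p}$, $K*U\in\mathbb{R}^{p\times p}$ is the linear map in $U$ given by $$(K*U)_{hk}=\sum_{a=1}^{3}\sum_{b=1}^{3}K_{ab}\,U_{h+a-2,\;k+b-2},\qquad h,k=1,\dots,p,$$ with the row and column indices of $U$ taken modulo $p$ in $\{1,\dots,p\}$. That is, the Frobenius inner product of $K$ is taken with each contiguous $3\times3$ submatrix of the periodically padded matrix. For a $1\times 1$ filter $K\in\mathbb{R}$, $K*U$ is the scalar multiple $KU$. Multi-channel convolution: for a third-order tensor $\boldsymbol{U}=[\boldsymbol U_1,\dots,\boldsymbol U_{C_i}]\in\mathbb{R}^{C_i\times p\times p}$ and a fourth-order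 tensor $\mathcal{K}\in\mathbb{R}^{C_o\times C_i\times s\times s}$ with filters $\mathcal{K}_{i,j}\in\mathbb{R}^{s\times s}$, the result $\mathcal{K}*\boldsymbol{U}\in\mathbb{R}^{C_o\times p\times p}$ has channels $$(\mathcal{K}*\boldsymbol{U})_i=\sum_{j=1}^{C_i}\mathcal{K}_{i,j}*\boldsymbol{U}_j\in\mathbb{R}^{p\times p},\qquad i=1,\dots,C_o.$$ A matrix in $\mathbb{R}^{p\times p}$ is identified with a tensor in $\mathbb{R}^{1\times p\times p}$. Adding a bias $b\in\mathbb{R}^{C_o}$ to a tensor in $\mathbb{R}^{C_o\times p\times p}$ means adding the scalar $b_i$ to every entry of the $i$-th channel. *)

(* Defs.v *)
From mathcomp Require Import all_boot all_order all_algebra.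
From mathcomp Require Import reals.
Set Implicit Arguments.
Unset Strict Implicit.
Unset Printing Implicit Defensive.
Import Order.TTheory GRing.Theory Num.Theory.
Local Open Scope ring_scope.

(* Channels are given as a finite function, so that equality of tensors is
   Leibniz equality; a fourth-order tensor is a Co x Ci matrix of filters. *)
Definition tensor (R : realType) (C p : nat) := {ffun 'I_C -> 'M[R]_p}.

Definition filters (R : realType) (Co Ci s : nat) := 'M['M[R]_s]_(Co, Ci).

Definition tensor_of_mx (R : realType) (p : nat) (U : 'M[R]_p) : tensor R 1 p :=
  [ffun=> U].

Lemma ord_bound_gt0 (p : nat) (h : 'I_p) : (0 < p)%N.
Proof. exact: leq_ltn_trans (leq0n h) (ltn_ord h). Qed.

(* The 1-based index h + a - 2 becomes h + a - 1 when h, a and the result are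
   all counted from 0; p.-1 stands for -1 modulo p. *)
Definition shift3 (p : nat) (h : 'I_p) (a : 'I_3) : 'I_p :=
  Ordinal (ltn_pmod (h + a + p.-1)%N (ord_bound_gt0 h)).

Definition conv3 (R : realType) (p : nat) (K : 'M[R]_3) (U : 'M[R]_p) : 'M[R]_p :=
  \matrix_(h, k) \sum_(a < 3) \sum_(b < 3) K a b * U (shift3 h a) (shift3 k b).

Definition conv1 (R : realType) (p : nat) (K : 'M[R]_1) (U : 'M[R]_p) : 'M[R]_p :=
  K 0 0 *: U.

(* [conv] is the single-filter convolution, conv3 for s = 3 and conv1 for
   s = 1. *)
Definition mconv (R : realType) (s p Co Ci : nat)
    (conv : 'M[R]_s -> 'M[R]_p -> 'M[R]_p)
    (K : filters R Co Ci s) (U : tensor R Ci p) : tensor R Co p :=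
  [ffun i => \sum_(j < Ci) conv (K i j) (U j)].

Definition add_bias (R : realType) (C p : nat)
    (U : tensor R C p) (b : 'cV[R]_C) : tensor R C p :=
  [ffun i => U i + const_mx (b i 0)].

Definition relu (R : realType) (x : R) : R := Num.max 0 x.

Definition tensor_relu (R : realType) (C p : nat) (U : tensor R C p) : tensor R C p :=
  [ffun i => map_mx (@relu R) (U i)].

Definition Ftheta (R : realType) (p : nat)
    (K : filters R 2 1 3) (H : filters R 1 2 1) (b1 : 'cV[R]_2) (b2 : R)
    (U : 'M[R]_p) : tensor R 1 p :=
  add_bias
    (mconv (@conv1 R p) H
      (tensor_relu (add_bias (mconv (@conv3 R p) K (tensor_of_mx U)) b1)))
    (const_mx b2).

(* Main.v *)
(** ReLU(x) - ReLU(-x) = x, so the filters L and -L followed by the weights 1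
    and -1 compute L * U with zero biases. *)
Require Import Defs.
From mathcomp Require Import all_boot all_order all_algebra.
From mathcomp Require Import reals.
Import Order.TTheory GRing.Theory Num.Theory.
Local Open Scope ring_scope.

(** Every real is its positive part minus its negative part. As convolution is odd in the filter
    ([conv3N]), the two hidden channels hold these parts of each entry of [conv3 L U], and the
    output weights subtract them ([relu_sub_reluN]). *)

Lemma relu_sub_reluN (R : realType) (x : R) : relu x - relu (- x) = x.
Proof.
rewrite /relu; case: (leP 0 x) => x0.
  by rewrite max_l ?oppr_le0 // subr0.
by rewrite max_r ?oppr_ge0 ?ltW // opprK add0r.
Qed.

Lemma conv3N (R : realType) (p : nat) (K : 'M[R]_3) (U : 'M[R]_p) :
  conv3 (- K) U = - conv3 K U.
Proof.
apply/matrixP => h k; rewrite !mxE -sumrN; apply: eq_bigr => a _.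
by rewrite -sumrN; apply: eq_bigr => b _; rewrite mxE mulNr.
Qed.

Theorem theorem2 (R : realType) (p : nat) (hp : (0 < p)%N) (L : 'M[R]_3) :
  exists (K : filters R 2 1 3) (H : filters R 1 2 1) (b1 : 'cV[R]_2) (b2 : R),
    forall U : 'M[R]_p, Ftheta K H b1 b2 U = tensor_of_mx (conv3 L U).
Proof.
exists (\matrix_(i, j) if i == 0 then L else - L).
exists (\matrix_(i, j) const_mx (if j == 0 then 1 else -1)), 0, 0 => U.
(* The outer sum splits into the two hidden channels; [!big_ord1] then collapses the sums over the
   single input channel. *)
apply/ffunP => i; rewrite !ffunE big_ord_recl big_ord1 !ffunE !big_ord1 !ffunE.
rewrite /conv1 !mxE /= conv3N; apply/matrixP => h k.
(* Entrywise this is [1 * relu x + (-1) * relu (- x) = x]. *)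
by rewrite ![in LHS]mxE !addr0 mul1r mulN1r relu_sub_reluN mxE.
Qed.
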